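(* The hyperbolic plane $\mathbb{H}^2$ does not admit a surjective homothety $h\colon\mathbb{H}^2\to\mathbb{H}^2$.
   Context: A map $h\colon X\to X$ on a metric space $(X,d)$ is called a homothety if there is some $\mu>1$ such that $d(h(x),h(y))=\mu\, d(x,y)$ for all $x,y\in X$. *)

(* Defs.v *)
From HB Require Import structures.
From mathcomp Require Import all_boot all_order all_algebra.
From mathcomp Require Import ring lra.
From mathcomp Require Import all_classical all_reals all_analysis.

Set Implicit Arguments.
Unset Strict Implicit.
Unset Printing Implicit Defensive.

Import Order.TTheory GRing.Theory Num.Theory.

Local Open Scope ring_scope.

Definition homothety (R : realType) (X : metricType R) (h : X -> X) : Prop :=
  exists2 mu : R, 1 < mu & forall x y : X, mdist (h x) (h y) = mu * mdist x y.

Section Arcosh.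
Context {R : realType}.
Implicit Types a b c x : R.

(* The inverse of cosh on [1, +oo[; only used there. *)
Definition arcosh x : R := ln (x + Num.sqrt (x ^+ 2 - 1)).

Lemma sqr_ge1 x : 1 <= x -> 0 <= x ^+ 2 - 1.
Proof. by move=> x1; nra. Qed.

Lemma arcosh_arg_ge1 x : 1 <= x -> 1 <= x + Num.sqrt (x ^+ 2 - 1).
Proof. by move=> x1; have := sqrtr_ge0 (x ^+ 2 - 1); lra. Qed.

Lemma arcosh1 : arcosh 1 = 0.
Proof. by rewrite /arcosh expr1n subrr sqrtr0 addr0 ln1. Qed.

Lemma arcosh_eq0 x : 1 <= x -> arcosh x = 0 -> x = 1.
Proof.
move=> x1 /eqP; have x'1 := arcosh_arg_ge1 x1.
rewrite /arcosh ln_eq0; last by lra.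
by move=> /eqP x'E; have := sqrtr_ge0 (x ^+ 2 - 1); lra.
Qed.

(* c <= cosh (arcosh a + arcosh b), squared and cleared of square roots *)
Lemma arcosh_le_add a b c : 1 <= a -> 1 <= b -> 1 <= c ->
  0 <= 1 + 2 * a * b * c - a ^+ 2 - b ^+ 2 - c ^+ 2 ->
  arcosh c <= arcosh a + arcosh b.
Proof.
move=> a1 b1 c1 gram.
have a'1 := arcosh_arg_ge1 a1; have b'1 := arcosh_arg_ge1 b1.
have c'1 := arcosh_arg_ge1 c1.
rewrite /arcosh -lnM ?posrE; [|lra|lra].
rewrite ler_ln ?posrE; [|lra|nra].
have sa := sqr_sqrtr (sqr_ge1 a1); have sb := sqr_sqrtr (sqr_ge1 b1).
have pa := sqrtr_ge0 (a ^+ 2 - 1); have pb := sqrtr_ge0 (b ^+ 2 - 1).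
move: sa sb pa pb {a'1 b'1 c'1}.
set s := Num.sqrt (a ^+ 2 - 1); set t := Num.sqrt (b ^+ 2 - 1) => sa sb pa pb.
have st0 : 0 <= s * t by exact: mulr_ge0.
have cM : c <= a * b + s * t.
  have [cab|abc] := leP c (a * b); first by lra.
  have : (c - a * b) ^+ 2 <= (s * t) ^+ 2.
    by rewrite exprMn sa sb; move: gram; rewrite -subr_ge0 => ?; nra.
  by rewrite ler_sqr ?nnegrE; lra.
have sN : Num.sqrt (c ^+ 2 - 1) <= a * t + s * b.
  have N0 : 0 <= a * t + s * b by rewrite addr_ge0// mulr_ge0//; lra.
  rewrite -(ger0_norm N0) -sqrtr_sqr ler_wsqrtr//.
  have -> : (a * t + s * b) ^+ 2 = (a * b + s * t) ^+ 2 - 1.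
    transitivity (a ^+ 2 * t ^+ 2 + s ^+ 2 * b ^+ 2 + 2 * a * b * s * t).
      by ring.
    transitivity (a ^+ 2 * b ^+ 2 + s ^+ 2 * t ^+ 2 + 2 * a * b * s * t - 1).
      by rewrite sa sb; ring.
    by ring.
  by rewrite lerD2r ler_sqr ?nnegrE; lra.
by apply: le_trans (lerD cM sN) _; rewrite le_eqVlt; apply/orP; left; apply/eqP; ring.
Qed.

End Arcosh.

(* The upper half-plane model: points x + iy with y > 0, with the distance    *)
(* induced by the Riemannian metric (dx^2 + dy^2) / y^2 of curvature -1.      *)
Definition hyperbolic_plane (R : realType) : Type := {p : R * R | 0 < p.2}.

HB.instance Definition _ (R : realType) := Choice.on (hyperbolic_plane R).

Section HyperbolicDistance.
Context {R : realType}.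
Implicit Types p q r : hyperbolic_plane R.

(* 1 + |z - w|^2 / (2 Im z Im w) *)
Definition hyp_cosh_dist p q : R :=
  let: (x, y) := val p in let: (x', y') := val q in
  1 + ((x - x') ^+ 2 + (y - y') ^+ 2) / (2 * y * y').

Definition hyp_dist p q : R := arcosh (hyp_cosh_dist p q).

Lemma hyp_cosh_dist_ge1 p q : 1 <= hyp_cosh_dist p q.
Proof.
case: p q => [[x y] /= y0] [[x' y'] /= y'0]; rewrite /hyp_cosh_dist/=.
by rewrite lerDl divr_ge0 ?addr_ge0 ?sqr_ge0// ?mulr_ge0// ltW.
Qed.

Lemma hyp_distxx p : hyp_dist p p = 0.
Proof.
case: p => [[x y] /= y0]; rewrite /hyp_dist /hyp_cosh_dist/=.
by rewrite !subrr expr0n addr0 mul0r addr0 arcosh1.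
Qed.

Lemma hyp_dist_positivity p q : hyp_dist p q = 0 -> p = q.
Proof.
move/(arcosh_eq0 (hyp_cosh_dist_ge1 p q)).
case: p q => [[x y] /= y0] [[x' y'] /= y'0]; rewrite /hyp_cosh_dist/=.
move/eqP; rewrite -subr_eq0 addrC addKr mulf_eq0 invr_eq0.
have /negPf -> : 2 * y * y' != 0 by rewrite !mulf_neq0// ?gt_eqF.
rewrite orbF paddr_eq0 ?sqr_ge0// !sqrf_eq0 !subr_eq0 => /andP[/eqP xx /eqP yy].
by apply: val_inj; rewrite /= xx yy.
Qed.

Lemma hyp_dist_sym p q : hyp_dist p q = hyp_dist q p.
Proof.
rewrite /hyp_dist; congr arcosh.
case: p q => [[x y] /= y0] [[x' y'] /= y'0]; rewrite /hyp_cosh_dist/=.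
by congr (1 + _ / _); ring.
Qed.

Lemma hyp_dist_triangle q p r : hyp_dist p r <= hyp_dist p q + hyp_dist q r.
Proof.
apply: arcosh_le_add; do ?exact: hyp_cosh_dist_ge1.
case: p q r => [[x y] /= y0] [[x' y'] /= y'0] [[x'' y''] /= y''0].
rewrite /hyp_cosh_dist/=.
(* Gram determinant of the three points in the hyperboloid model *)
pose D := (x ^+ 2 + y ^+ 2) * (x' - x'') + (x' ^+ 2 + y' ^+ 2) * (x'' - x)
          + (x'' ^+ 2 + y'' ^+ 2) * (x - x').
rewrite [leRHS](_ : _ = (D / (2 * y * y' * y'')) ^+ 2) ?sqr_ge0//.
by rewrite /D; field; rewrite !gt_eqF.
Qed.

End HyperbolicDistance.

HB.instance Definition _ (R : realType) :=
  @isMetric.Build R (hyperbolic_plane R) hyp_dist hyp_distxx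
    hyp_dist_positivity hyp_dist_sym hyp_dist_triangle.

Lemma hyp_mdistE (R : realType) (p q : hyperbolic_plane R) :
  mdist p q = hyp_dist p q.
Proof. by []. Qed.

(* Main.v *)
Require Import Defs.
From mathcomp Require Import all_boot all_order all_algebra.
From mathcomp Require Import ring lra.
From mathcomp Require Import all_classical all_reals all_analysis.

(** The hyperbolic plane is Gromov hyperbolic: up to an additive constant, four
    points satisfy the distance inequality of a tree.  Pulled back along the
    iterates of a homothety, that inequality would hold with arbitrarily small
    constants, as if the plane were a tree.  Metric squares suffice to make
    this precise: four points whose sides all have length [S] and whose two
    diagonals both have length [C].

    In the upper half-plane, [cosh d(z, w) - 1 = |z - w|^2 / (2 Im z Im w)].
    Ptolemy's inequality in the Euclidean plane therefore holds verbatim for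
    the square roots of the quantities [cosh d - 1], because all three products
    of opposite pairs carry the same four imaginary parts.  For a square it
    reads [cosh C - 1 <= 2 (cosh S - 1)], which forces [C <= S + 1]
    ([hyp_square_diag_le]): a diagonal exceeds a side by at most a constant.

    The [n]-th iterate of a homothety of ratio [mu] turns a square of side [s]
    and diagonal [c] into one of side [mu ^ n * s] and diagonal [mu ^ n * c],
    so [mu ^ n * (c - s) <= 1] for all [n].  As [mu > 1], this is absurd as
    soon as one square with [s < c] exists.  Such a square is given by
    [2i, 3/5 + 4i/5, i/2, -3/5 + 4i/5], which is centred at [i]. *)

Set Implicit Arguments.
Unset Strict Implicit.
Unset Printing Implicit Defensive.

Import Order.TTheory GRing.Theory Num.Theory.

Local Open Scope ring_scope.
Local Open Scope classical_set_scope.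

Definition cosh (R : realType) (x : R) : R := (expR x + expR (- x)) / 2.

Lemma cosh_ge1 (R : realType) (x : R) : 1 <= cosh x.
Proof.
rewrite /cosh expRN; have e0 := expR_gt0 x; set e := expR x in e0 *.
rewrite -subr_ge0 [leRHS](_ : _ = (e - 1) ^+ 2 / (2 * e)).
  by rewrite divr_ge0 ?sqr_ge0// mulr_ge0// ltW.
by field; rewrite gt_eqF.
Qed.

Lemma arcoshK (R : realType) (x : R) : 1 <= x -> cosh (arcosh x) = x.
Proof.
move=> x1; have E1 := arcosh_arg_ge1 x1; have sq := sqr_sqrtr (sqr_ge1 x1).
rewrite /cosh /arcosh expRN lnK ?posrE; last by lra.
move: E1 sq; set s := Num.sqrt _ => E1 sq.
have -> : (x + s)^-1 = x - s.
  have E0 : x + s != 0 by rewrite gt_eqF//; lra.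
  apply: (mulfI E0); rewrite divff//.
  by transitivity (x ^+ 2 - s ^+ 2); [rewrite sq|]; ring.
by field.
Qed.

Lemma arcosh_lt (R : realType) (x y : R) :
  1 <= x -> x < y -> arcosh x < arcosh y.
Proof.
move=> x1 xy; have y1 : 1 <= y by lra.
have x'1 := arcosh_arg_ge1 x1; have y'1 := arcosh_arg_ge1 y1.
rewrite /arcosh ltr_ln ?posrE; [|lra|lra].
by rewrite ltr_leD// ler_wsqrtr//; nra.
Qed.

(** The reason is that [cosh] grows like [exp / 2], so that a constant factor
    between two values of [cosh] is a constant difference between the
    arguments. *)
Lemma cosh_dilation_le (R : realType) (a b : R) :
  0 <= b -> cosh a - 1 <= 2 * (cosh b - 1) -> a <= b + 1.
Proof.
move=> b0 ab.
have expab : expR a <= 2 * expR b.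
  have := expR_ge0 (- a); have : expR (- b) <= 1 by rewrite -expR0 ler_expR; lra.
  by move: ab; rewrite /cosh; lra.
have : expR (a - b) <= 2 by rewrite expRD expRN ler_pdivrMr ?expR_gt0.
by have := expR_ge1Dx (a - b); lra.
Qed.

(** The complex identity [(a - c)(b - d) = (a - b)(c - d) + (a - d)(b - c)]
    gives Ptolemy's inequality by the triangle inequality.  The bound
    [|u + v|^2 <= 2 (|u|^2 + |v|^2)] used here instead avoids square roots, and
    it is as strong as [|u + v| <= |u| + |v|] when [|u| = |v|], which is the
    case for the products of opposite sides of a hyperbolic square. *)
Lemma ptolemy_sqr (R : realDomainType) (xa ya xb yb xc yc xd yd : R) :
  ((xa - xc) ^+ 2 + (ya - yc) ^+ 2) * ((xb - xd) ^+ 2 + (yb - yd) ^+ 2) <=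
  2 * (((xa - xb) ^+ 2 + (ya - yb) ^+ 2) * ((xc - xd) ^+ 2 + (yc - yd) ^+ 2) +
       ((xa - xd) ^+ 2 + (ya - yd) ^+ 2) * ((xb - xc) ^+ 2 + (yb - yc) ^+ 2)).
Proof.
(* real and imaginary parts of (a - b)(c - d) - (a - d)(b - c) *)
pose re := ((xa - xb) * (xc - xd) - (ya - yb) * (yc - yd)) -
           ((xa - xd) * (xb - xc) - (ya - yd) * (yb - yc)).
pose im := ((xa - xb) * (yc - yd) + (ya - yb) * (xc - xd)) -
           ((xa - xd) * (yb - yc) + (ya - yd) * (xb - xc)).
rewrite -subr_ge0 [leRHS](_ : _ = re ^+ 2 + im ^+ 2) ?addr_ge0 ?sqr_ge0//.
by rewrite /re /im; ring.
Qed.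

Definition metric_square (R : realType) (X : metricType R) (S C : R)
    (p q r s : X) : Prop :=
  [/\ [/\ mdist p q = S, mdist q r = S, mdist r s = S & mdist p s = S],
      mdist p r = C & mdist q s = C].

Section HyperbolicSquares.
Context {R : realType}.
Implicit Types p q r s : hyperbolic_plane R.

Lemma im_gt0 p : 0 < (val p).2.
Proof. by case: p. Qed.

Lemma cosh_mdist p q : cosh (mdist p q) = hyp_cosh_dist p q.
Proof. by rewrite hyp_mdistE arcoshK// hyp_cosh_dist_ge1. Qed.

Lemma sqr_euclidean_dist p q :
  ((val p).1 - (val q).1) ^+ 2 + ((val p).2 - (val q).2) ^+ 2 =
  2 * (val p).2 * (val q).2 * (cosh (mdist p q) - 1).
Proof.
rewrite cosh_mdist; case: p q => [[x y] /= y0] [[x' y'] /= y'0].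
by rewrite /hyp_cosh_dist/=; field; rewrite !gt_eqF.
Qed.

(** Ptolemy's inequality for the square: the imaginary parts of the four
    points enter both sides through the same factor and cancel. *)
Lemma hyp_square_ptolemy (S C : R) p q r s :
  metric_square S C p q r s -> cosh C - 1 <= 2 * (cosh S - 1).
Proof.
move=> [[pq qr rs ps] pr qs].
have := ptolemy_sqr (val p).1 (val p).2 (val q).1 (val q).2
                    (val r).1 (val r).2 (val s).1 (val s).2.
rewrite !sqr_euclidean_dist pq qr rs ps pr qs.
have := cosh_ge1 C; have := cosh_ge1 S.
move: (cosh C) (cosh S) => k l l1 k1.
set yp := (val p).2; set yq := (val q).2; set yr := (val r).2.
set ys := (val s).2.
have Y0 : 0 < 4 * (yp * yq * yr * ys).
  by rewrite !mulr_gt0// im_gt0.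
rewrite [leLHS](_ : _ = 4 * (yp * yq * yr * ys) * (k - 1) ^+ 2); last by ring.
rewrite [leRHS](_ : _ = 4 * (yp * yq * yr * ys) * (2 * (l - 1)) ^+ 2).
  by rewrite ler_pM2l// ler_sqr ?nnegrE//; lra.
by ring.
Qed.

Lemma hyp_square_diag_le (S C : R) p q r s :
  metric_square S C p q r s -> C <= S + 1.
Proof.
move=> sq; apply: cosh_dilation_le (hyp_square_ptolemy sq).
by case: sq => [[<- _ _ _] _ _]; exact: mdist_ge0.
Qed.

(** The side and the diagonal have hyperbolic cosines 25/16 and 17/8.  The
    square has two vertices on the imaginary axis, exchanged by [z |-> -1/z],
    and two on the unit circle; the angle of the latter, from the 3-4-5
    triangle, makes the two diagonals equal. *)
Lemma hyp_square_exists :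
  exists (S C : R) p q r s, S < C /\ metric_square S C p q r s.
Proof.
pose pt (z : R * R) (z0 : 0 < z.2) : hyperbolic_plane R :=
  exist (fun z : R * R => 0 < z.2) z z0.
have p0 : 0 < ((0, 2) : R * R).2 by rewrite /=; lra.
have q0 : 0 < ((3 / 5, 4 / 5) : R * R).2 by rewrite /=; lra.
have r0 : 0 < ((0, 1 / 2) : R * R).2 by rewrite /=; lra.
have s0 : 0 < ((- (3 / 5), 4 / 5) : R * R).2 by rewrite /=; lra.
exists (arcosh (25 / 16)), (arcosh (17 / 8)).
exists (pt _ p0), (pt _ q0), (pt _ r0), (pt _ s0).
split; first by apply: arcosh_lt; lra.
by do 2?split; rewrite hyp_mdistE /hyp_dist /hyp_cosh_dist/=;
  congr arcosh; field.
Qed.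

End HyperbolicSquares.

Lemma mdist_iter (R : realType) (X : metricType R) (h : X -> X) (mu : R) n :
  (forall x y, mdist (h x) (h y) = mu * mdist x y) ->
  forall x y, mdist (iter n h x) (iter n h y) = mu ^+ n * mdist x y.
Proof.
move=> hmu x y; elim: n => [|n IHn]; first by rewrite expr0 mul1r.
by rewrite !iterS hmu IHn exprS mulrA.
Qed.

(** Bernoulli's inequality [1 + n e <= (1 + e) ^ n] and the Archimedean
    property. *)
Lemma geometric_unbounded (R : realType) (mu b : R) :
  1 < mu -> exists n, b < mu ^+ n.
Proof.
move=> mu1.
have bernoulli n : 1 + n%:R * (mu - 1) <= mu ^+ n.
  elim: n => [|n IHn]; first by rewrite mul0r addr0 expr0.
  have mu0 : 0 <= mu by lra.
  rewrite exprS -natr1; apply: le_trans (ler_wpM2l mu0 IHn).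
  by have := mulr_ge0 (ler0n R n) (sqr_ge0 (mu - 1)); lra.
exists (Num.truncn (b / (mu - 1))).+1.
apply: lt_le_trans (bernoulli _).
have := truncnS_gt (b / (mu - 1)); rewrite ltr_pdivrMr; lra.
Qed.

Theorem corollary1p9 (R : realType) :
  ~ exists h : hyperbolic_plane R -> hyperbolic_plane R,
      homothety h /\ set_surj [set: hyperbolic_plane R] [set: hyperbolic_plane R] h.
Proof.
move=> [h [[mu mu1 hmu] _]].
have [S [C [p [q [r [s [SC [[pq qr rs ps] pr qs]]]]]]]] := @hyp_square_exists R.
have [n large] := geometric_unbounded (1 / (C - S)) mu1.
have /hyp_square_diag_le : metric_square (mu ^+ n * S) (mu ^+ n * C)
    (iter n h p) (iter n h q) (iter n h r) (iter n h s).
  by do 2?split; rewrite (mdist_iter n hmu); congr (_ * _).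
by move: large; rewrite ltr_pdivrMr; lra.
Qed.
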